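(* Let $A\in\mathbb{Q}^{m\times n}$ be a quaternion matrix with nonzero singular values $\sigma_1\ge\sigma_2\ge\cdots\ge\sigma_r>0$, and let $X_0=\alpha A^{H}$ with $0<\alpha<\frac{2}{\sigma_1^2}$. Let $\{X_j\}_{j\ge0}$ be the sequence generated from $X_0$ by the QHPI19 iteration (defined in the context, run without stopping test). Then $X_j$ converges to the Moore--Penrose inverse $A^{\dagger}$ of $A$, and for all $j\ge0$ $$\|X_{j+1}-A^{\dagger}\|\le\|A^{\dagger}\|\,\|A\|^{19}\,\|X_j-A^{\dagger}\|^{19}.$$
   Context: $\mathbb{Q}$ denotes the skew field of real quaternions; $A^{H}=\overline{A}^{\top}$ is the conjugate transpose; singular values are those of the quaternion SVD $A=U\Sigma V^{H}$ ($U,V$ unitary quaternion matrices, $\Sigma$ real nonnegative diagonal). $\|\cdot\|$ is the operator 2-norm $\|A\|=\sup_{\|x\|_2=1}\|Ax\|_2$ with $\|x\|_2=\sqrt{x^{H}x}$. The Moore--Penrose inverse $A^{\dagger}$ is the unique $X$ with $AXA=A$, $XAX=X$, $(AX)^{H}=AX$, $(XA)^{H}=XA$. QHPI19 iteration: given $X_j\in\mathbb{Q}^{n\times m}$, with $I=I_m$, set $R_j=I-AX_j$, $U_j=(I+d_1R_j^2+R_j^4)(I+d_2R_j^2+R_j^4)$, $V_j=U_j+d_3R_j^2$, $W_j=U_j+e_1R_j^2+e_2R_j^4$, $\Gamma_j=V_jW_j+c_1R_j^2+c_2R_j^4$, $X_{j+1}=X_j\big(I+(R_j+R_j^2)\Gamma_j\big)$,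 with the real coefficients $d_1=\frac14\big(1+\sqrt{27-2\sqrt{93}}\big)$, $d_2=\frac14\big(1-\sqrt{27-2\sqrt{93}}\big)$, $d_3=\frac1{496}(5\sqrt{93}-93)$, $e_1=\frac1{496}(-93-5\sqrt{93})$, $e_2=-\frac{\sqrt{93}}4$, $c_1=\frac38$, $c_2=\frac{321}{1984}$. *)

(* Defs.v *)
From HB Require Import structures.
From mathcomp Require Import all_boot all_order all_algebra.
From mathcomp Require Import ring.
From mathcomp Require Import all_classical all_reals all_analysis.
Set Implicit Arguments.
Unset Strict Implicit.
Unset Printing Implicit Defensive.
Import Order.TTheory GRing.Theory Num.Theory.
Import numFieldNormedType.Exports.
Local Open Scope classical_set_scope.
Local Open Scope ring_scope.

(* Quat a b c d is the quaternion a + b i + c j + d k. *)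
Record quat (R : Type) := Quat { qre : R; qi : R; qj : R; qk : R }.

Definition quat_tuple (R : Type) (x : quat R) : R * R * R * R :=
  (qre x, qi x, qj x, qk x).

Definition tuple_quat (R : Type) (t : R * R * R * R) : quat R :=
  let: (a, b, c, d) := t in Quat a b c d.

Lemma quat_tupleK (R : Type) : cancel (@quat_tuple R) (@tuple_quat R).
Proof. by case. Qed.

HB.instance Definition _ (R : choiceType) :=
  Choice.copy (quat R) (can_type (@quat_tupleK R)).

Definition addq (R : comNzRingType) (x y : quat R) : quat R :=
  Quat (qre x + qre y) (qi x + qi y) (qj x + qj y) (qk x + qk y).

Definition oppq (R : comNzRingType) (x : quat R) : quat R :=
  Quat (- qre x) (- qi x) (- qj x) (- qk x).

Definition mulq (R : comNzRingType) (x y : quat R) : quat R :=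
  Quat
    (qre x * qre y - qi x * qi y - qj x * qj y - qk x * qk y)
    (qre x * qi y + qi x * qre y + qj x * qk y - qk x * qj y)
    (qre x * qj y - qi x * qk y + qj x * qre y + qk x * qi y)
    (qre x * qk y + qi x * qj y - qj x * qi y + qk x * qre y).

Definition qreal (R : comNzRingType) (a : R) : quat R := Quat a 0 0 0.

Notation "a %:q" := (qreal a) (at level 2, format "a %:q") : ring_scope.

Definition qconj (R : comNzRingType) (x : quat R) : quat R :=
  Quat (qre x) (- qi x) (- qj x) (- qk x).

Lemma addqA (R : comNzRingType) : associative (@addq R).
Proof. by move=> [? ? ? ?] [? ? ? ?] [? ? ? ?]; rewrite /addq /= !addrA. Qed.

Lemma addqC (R : comNzRingType) : commutative (@addq R).
Proof. by move=> [? ? ? ?] [? ? ? ?]; congr Quat; rewrite /= addrC. Qed.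

Lemma add0q (R : comNzRingType) : left_id (0%:q) (@addq R).
Proof. by move=> [? ? ? ?]; rewrite /addq /= !add0r. Qed.

Lemma addNq (R : comNzRingType) : left_inverse (0%:q) (@oppq R) (@addq R).
Proof. by move=> [? ? ? ?]; rewrite /addq /= !addNr. Qed.

HB.instance Definition _ (R : comNzRingType) :=
  GRing.isZmodule.Build (quat R) (@addqA R) (@addqC R) (@add0q R) (@addNq R).

Lemma mulqA (R : comNzRingType) : associative (@mulq R).
Proof. by move=> [? ? ? ?] [? ? ? ?] [? ? ? ?]; congr Quat => /=; ring. Qed.

Lemma mul1q (R : comNzRingType) : left_id (1%:q) (@mulq R).
Proof. by move=> [? ? ? ?]; congr Quat => /=; ring. Qed.

Lemma mulq1 (R : comNzRingType) : right_id (1%:q) (@mulq R).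
Proof. by move=> [? ? ? ?]; congr Quat => /=; ring. Qed.

Lemma mulqDl (R : comNzRingType) : left_distributive (@mulq R) (@addq R).
Proof. by move=> [? ? ? ?] [? ? ? ?] [? ? ? ?]; congr Quat => /=; ring. Qed.

Lemma mulqDr (R : comNzRingType) : right_distributive (@mulq R) (@addq R).
Proof. by move=> [? ? ? ?] [? ? ? ?] [? ? ? ?]; congr Quat => /=; ring. Qed.

Lemma oneq_neq0 (R : comNzRingType) : 1%:q != 0%:q :> quat R.
Proof. by apply/eqP => -[] /eqP; rewrite oner_eq0. Qed.

HB.instance Definition _ (R : comNzRingType) :=
  GRing.Zmodule_isNzRing.Build (quat R)
    (@mulqA R) (@mul1q R) (@mulq1 R) (@mulqDl R) (@mulqDr R) (@oneq_neq0 R).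

Definition qadj (R : comNzRingType) (m n : nat) (A : 'M[quat R]_(m, n)) :
  'M[quat R]_(n, m) := map_mx (@qconj R) A^T.

Definition qunitary (R : comNzRingType) (n : nat) (U : 'M[quat R]_n) : Prop :=
  qadj U *m U = 1%:M /\ U *m qadj U = 1%:M.

(* The only entry of x^H x is the real number \sum_i |x_i|^2. *)
Definition qvnorm (R : realType) (n : nat) (x : 'cV[quat R]_n) : R :=
  Num.sqrt (qre ((qadj x *m x) 0 0)).

(* For n = 0 there is no unit vector, and sup set0 = 0. *)
Definition qopnorm (R : realType) (m n : nat) (A : 'M[quat R]_(m, n)) : R :=
  sup [set qvnorm (A *m x) | x in [set x : 'cV[quat R]_n | qvnorm x = 1]].

Definition qsigma_mx (R : realType) (m n : nat) (s : seq R) :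
  'M[quat R]_(m, n) :=
  \matrix_(i < m, j < n) (if (i : nat) == j then (s`_i)%:q else 0).

(* s lists the nonzero singular values in nonincreasing order, with
   multiplicity; the remaining diagonal entries of Sigma are the default
   value 0 of s`_i. *)
Definition nonzero_singular_values (R : realType) (m n : nat)
    (A : 'M[quat R]_(m, n)) (s : seq R) : Prop :=
  [/\ (size s <= minn m n)%N,
      sorted (fun x y : R => y <= x) s,
      all (fun x : R => 0 < x) s
    & exists (U : 'M[quat R]_m) (V : 'M[quat R]_n),
        [/\ qunitary U, qunitary V & A = U *m qsigma_mx m n s *m qadj V]].

Definition is_mpinv (R : realType) (m n : nat)
    (A : 'M[quat R]_(m, n)) (X : 'M[quat R]_(n, m)) : Prop :=
  [/\ A *m X *m A = A,
      X *m A *m X = X,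
      qadj (A *m X) = A *m X
    & qadj (X *m A) = X *m A].

Definition mpinv (R : realType) (m n : nat) (A : 'M[quat R]_(m, n)) :
  'M[quat R]_(n, m) := xget 0 [set X | is_mpinv A X].

Definition coef_d1 (R : realType) : R :=
  (1 + Num.sqrt (27 - 2 * Num.sqrt 93)) / 4.
Definition coef_d2 (R : realType) : R :=
  (1 - Num.sqrt (27 - 2 * Num.sqrt 93)) / 4.
Definition coef_d3 (R : realType) : R := (5 * Num.sqrt 93 - 93) / 496.
Definition coef_e1 (R : realType) : R := (- 93 - 5 * Num.sqrt 93) / 496.
Definition coef_e2 (R : realType) : R := - Num.sqrt 93 / 4.
Definition coef_c1 (R : realType) : R := 3 / 8.
Definition coef_c2 (R : realType) : R := 321 / 1984.

Definition qhpi19_step (R : realType) (m n : nat)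
    (A : 'M[quat R]_(m, n)) (X : 'M[quat R]_(n, m)) : 'M[quat R]_(n, m) :=
  let Rj := 1%:M - A *m X in
  let U := (1 + (coef_d1 R)%:q *: Rj ^+ 2 + Rj ^+ 4)
           * (1 + (coef_d2 R)%:q *: Rj ^+ 2 + Rj ^+ 4) in
  let V := U + (coef_d3 R)%:q *: Rj ^+ 2 in
  let W := U + (coef_e1 R)%:q *: Rj ^+ 2 + (coef_e2 R)%:q *: Rj ^+ 4 in
  let G := V * W + (coef_c1 R)%:q *: Rj ^+ 2 + (coef_c2 R)%:q *: Rj ^+ 4 in
  X *m (1 + (Rj + Rj ^+ 2) * G).

(* Main.v *)
From HB Require Import structures.
Require Import Defs.
From mathcomp Require Import all_boot all_order all_algebra.
From mathcomp Require Import ring lra.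
From mathcomp Require Import all_classical all_reals all_analysis.
Set Implicit Arguments.
Unset Strict Implicit.
Import Order.TTheory GRing.Theory Num.Theory.
Import numFieldNormedType.Exports.
Local Open Scope classical_set_scope.
Local Open Scope ring_scope.

(** Why the theorem holds.

    Write Y for the Moore-Penrose inverse of A, R = I - A X_j for the residual
    and E = Y - X_j for the error. The coefficients of the iteration are a
    solution of the equations that make its factored polynomial equal to
    1 + R + ... + R^18 (factored_geometric, qhpi19_poly), with few matrix
    products. Real quaternions are central, so this identity of real
    polynomials may be evaluated at a quaternion matrix, and one step is
    X_(j+1) = X_j (1 + R + ... + R^18) (qhpi19_stepE). The geometric sum gives
    A X_(j+1) = I - R^19.

    The relations Y A X_j = X_j and X_j A Y = X_j hold for X_0, a multiple of
    the adjoint of A, and are preserved by the step. They imply that Y R = Y F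
    and F R = F^2 for F = A E, hence the exact error formula
    Y - X_(j+1) = Y R^19 = Y F^19 (qhpi19_error). The bound of order 19 follows
    from it because the operator norm is submultiplicative. That the supremum
    defining this norm is finite is qmulmx_bounded.

    For the convergence, multiply the error formula by A: F_(j+1) = F_j^19, so
    it is enough that F_0 has norm less than 1. In the singular bases F_0 is
    diagonal, with entry 1 - alpha sigma^2 for each nonzero singular value
    sigma and 0 elsewhere; the choice of alpha puts each of these entries in
    ]-1, 1[ (initial_residual_lt1). Finally Y - X_j = Y F_j tends to 0. *)

(** * Quaternions and their adjoint matrices *)

Lemma qreal_is_additive (R : comNzRingType) : additive (@qreal R).
Proof. by move=> a b; congr Quat; rewrite /= ?subr0. Qed.

Lemma qreal_is_monoid_morphism (R : comNzRingType) :
  monoid_morphism (@qreal R).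
Proof. by split=> // a b; congr Quat => /=; ring. Qed.

HB.instance Definition _ (R : comNzRingType) :=
  GRing.isZmodMorphism.Build R (quat R) (@qreal R) (@qreal_is_additive R).
HB.instance Definition _ (R : comNzRingType) :=
  GRing.isMonoidMorphism.Build R (quat R) (@qreal R)
    (@qreal_is_monoid_morphism R).

Lemma qreal_central (R : comNzRingType) (a : R) (x : quat R) :
  a%:q * x = x * a%:q.
Proof. by case: x => ? ? ? ?; congr Quat => /=; ring. Qed.

Lemma qconj_is_additive (R : comNzRingType) : additive (@qconj R).
Proof. by move=> a b; congr Quat; rewrite /= ?opprD. Qed.

HB.instance Definition _ (R : comNzRingType) :=
  GRing.isZmodMorphism.Build (quat R) (quat R) (@qconj R)
    (@qconj_is_additive R).

Lemma qconjM (R : comNzRingType) (x y : quat R) :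
  qconj (x * y) = qconj y * qconj x.
Proof. by case: x => ? ? ? ?; case: y => ? ? ? ?; congr Quat => /=; ring. Qed.

Lemma qconj_real (R : comNzRingType) (a : R) : qconj a%:q = a%:q.
Proof. by rewrite /qconj /= oppr0. Qed.

Lemma qre_is_additive (R : comNzRingType) : additive (@qre R).
Proof. by []. Qed.

HB.instance Definition _ (R : comNzRingType) :=
  GRing.isZmodMorphism.Build (quat R) R (@qre R) (@qre_is_additive R).

Lemma qadjM (R : comNzRingType) (m n p : nat)
    (A : 'M[quat R]_(m, n)) (B : 'M[quat R]_(n, p)) :
  qadj (A *m B) = qadj B *m qadj A.
Proof.
apply/matrixP => i j; rewrite !mxE raddf_sum; apply: eq_bigr => k _.
by rewrite /= qconjM !mxE.
Qed.

Lemma qadjK (R : comNzRingType) (m n : nat) (A : 'M[quat R]_(m, n)) :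
  qadj (qadj A) = A.
Proof.
apply/matrixP => i j; rewrite !mxE; case: (A i j) => a b c d.
by rewrite /qconj /= !opprK.
Qed.

(** Over a skew field scalars do not pass through a left factor; real ones
    do, because they are central. *)
Lemma scalemx_realAr (R : comNzRingType) (m n p : nat) (a : R)
    (A : 'M[quat R]_(m, n)) (B : 'M[quat R]_(n, p)) :
  A *m (a%:q *: B) = a%:q *: (A *m B).
Proof.
apply/matrixP => i j; rewrite !mxE mulr_sumr; apply: eq_bigr => k _.
by rewrite !mxE !mulrA qreal_central.
Qed.

(** * The operator norm *)

Definition qnormsq (R : comNzRingType) (x : quat R) : R :=
  qre x ^+ 2 + qi x ^+ 2 + qj x ^+ 2 + qk x ^+ 2.

Lemma qnormsqM (R : comNzRingType) (x y : quat R) :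
  qnormsq (x * y) = qnormsq x * qnormsq y.
Proof.
by case: x => ? ? ? ?; case: y => ? ? ? ?; rewrite /qnormsq /=; ring.
Qed.

Lemma qnormsq_real (R : comNzRingType) (a : R) : qnormsq a%:q = a ^+ 2.
Proof. by rewrite /qnormsq /= expr0n /= !addr0. Qed.

Lemma qnormsq_ge0 (R : realType) (x : quat R) : 0 <= qnormsq x.
Proof. by rewrite !addr_ge0 ?sqr_ge0. Qed.

Lemma qnormsq_eq0 (R : realType) (x : quat R) : qnormsq x = 0 -> x = 0.
Proof.
case: x => a b c d; rewrite /qnormsq /= => h.
have ha := sqr_ge0 a; have hb := sqr_ge0 b.
have hc := sqr_ge0 c; have hd := sqr_ge0 d.
have [a0 b0 c0 d0] : [/\ a ^+ 2 = 0, b ^+ 2 = 0, c ^+ 2 = 0 & d ^+ 2 = 0].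
  by split; lra.
by move: a0 b0 c0 d0 => /eqP + /eqP + /eqP + /eqP;
  rewrite !sqrf_eq0 => /eqP -> /eqP -> /eqP -> /eqP ->.
Qed.

Lemma qnormsq_add_le (R : realType) (x y : quat R) :
  qnormsq (x + y) <= 2 * qnormsq x + 2 * qnormsq y.
Proof.
case: x => a b c d; case: y => a' b' c' d'; rewrite /qnormsq /=.
have := sqr_ge0 (a - a'); have := sqr_ge0 (b - b').
have := sqr_ge0 (c - c'); have := sqr_ge0 (d - d').
nra.
Qed.

(** The exponential constant is crude, but it only has to show that a supremum
    is finite, and it avoids the Cauchy-Schwarz inequality. *)
Lemma qnormsq_sum_le (R : realType) (I : Type) (s : seq I) (F : I -> quat R) :
  qnormsq (\sum_(i <- s) F i) <=
    2 ^+ size s * \sum_(i <- s) qnormsq (F i).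
Proof.
elim: s => [|i s IHs]; first by rewrite !big_nil mulr0 qnormsq_real expr0n.
rewrite !big_cons /= (le_trans (qnormsq_add_le _ _)) // exprS -mulrA -mulrDr.
rewrite ler_pM2l ?ltr0n // mulrDr lerD // ler_peMl ?qnormsq_ge0 //.
by rewrite exprn_ege1 // ler1n.
Qed.

Definition qvnormsq (R : comNzRingType) (n : nat) (x : 'cV[quat R]_n) : R :=
  \sum_i qnormsq (x i 0).

Lemma qvnormsq_ge0 (R : realType) (n : nat) (x : 'cV[quat R]_n) :
  0 <= qvnormsq x.
Proof. by apply: sumr_ge0 => i _; exact: qnormsq_ge0. Qed.

Lemma qvnormsqE (R : comNzRingType) (n : nat) (x : 'cV[quat R]_n) :
  qre ((qadj x *m x) 0 0) = qvnormsq x.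
Proof.
rewrite mxE raddf_sum; apply: eq_bigr => i _; rewrite !mxE.
by case: (x i 0) => a b c d; rewrite /qnormsq /=; ring.
Qed.

Lemma qvnormE (R : realType) (n : nat) (x : 'cV[quat R]_n) :
  qvnorm x = Num.sqrt (qvnormsq x).
Proof. by rewrite /qvnorm qvnormsqE. Qed.

Lemma qvnorm_ge0 (R : realType) (n : nat) (x : 'cV[quat R]_n) : 0 <= qvnorm x.
Proof. exact: sqrtr_ge0. Qed.

Lemma qvnorm_unitary (R : realType) (n : nat) (U : 'M[quat R]_n)
    (x : 'cV[quat R]_n) :
  qadj U *m U = 1%:M -> qvnorm (U *m x) = qvnorm x.
Proof.
by move=> UU; rewrite /qvnorm qadjM mulmxA -(mulmxA (qadj x)) UU mulmx1.
Qed.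

Lemma qvnormZ (R : realType) (n : nat) (a : R) (x : 'cV[quat R]_n) :
  qvnorm (a%:q *: x) = `|a| * qvnorm x.
Proof.
rewrite !qvnormE -sqrtr_sqr -sqrtrM ?sqr_ge0 // /qvnormsq mulr_sumr.
by congr Num.sqrt; apply: eq_bigr => i _; rewrite mxE qnormsqM qnormsq_real.
Qed.

Lemma qvnorm_eq0 (R : realType) (n : nat) (x : 'cV[quat R]_n) :
  qvnorm x = 0 -> x = 0.
Proof.
move=> /eqP; rewrite qvnormE sqrtr_eq0 => x_le0.
have /eqP : qvnormsq x = 0 by apply/eqP; rewrite eq_le x_le0 qvnormsq_ge0.
rewrite psumr_eq0 => [/allP x0|i _]; last exact: qnormsq_ge0.
apply/matrixP => i j; rewrite ord1 mxE; apply: qnormsq_eq0.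
by apply/eqP; apply: x0; rewrite mem_index_enum.
Qed.

(** Without this bound the supremum in [qopnorm] would have the default value
    0. A unit vector has entries of norm at most 1, so the entries of [A *m x]
    are bounded in terms of those of [A]. *)
Lemma qmulmx_bounded (R : realType) (m n : nat) (A : 'M[quat R]_(m, n)) :
  has_ubound [set qvnorm (A *m x) | x in [set x : 'cV_n | qvnorm x = 1]].
Proof.
exists (Num.sqrt (\sum_i 2 ^+ size (index_enum 'I_n)
                   * \sum_(j < n) qnormsq (A i j))).
move=> _ [x /= x1 <-]; rewrite qvnormE ler_sqrt; last first.
  apply: sumr_ge0 => i _; rewrite mulr_ge0 ?exprn_ge0 ?ler0n //.
  by apply: sumr_ge0 => j _; exact: qnormsq_ge0.
have xj_le1 j : qnormsq (x j 0) <= 1.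
  have <- : qvnormsq x = 1.
    by rewrite -(sqr_sqrtr (qvnormsq_ge0 x)) -qvnormE x1 expr1n.
  rewrite /qvnormsq (bigD1 j) //= lerDl.
  by apply: sumr_ge0 => k _; exact: qnormsq_ge0.
apply: ler_sum => i _; rewrite mxE (le_trans (qnormsq_sum_le _ _)) //.
rewrite ler_pM2l ?exprn_gt0 ?ltr0n //; apply: ler_sum => j _.
by rewrite qnormsqM ler_piMr ?qnormsq_ge0.
Qed.

Lemma qopnorm_ge0 (R : realType) (m n : nat) (A : 'M[quat R]_(m, n)) :
  0 <= qopnorm A.
Proof.
rewrite /qopnorm; set S := (X in sup X).
have [->|/set0P [y Sy]] := eqVneq S set0; first by rewrite sup0.
apply: le_trans (ub_le_sup (qmulmx_bounded A) Sy).
by case: Sy => x _ <-; exact: qvnorm_ge0.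
Qed.

Lemma qvnorm_mulmx_le (R : realType) (m n : nat) (A : 'M[quat R]_(m, n))
    (x : 'cV[quat R]_n) :
  qvnorm (A *m x) <= qopnorm A * qvnorm x.
Proof.
have [x0|x_neq0] := eqVneq (qvnorm x) 0.
  by rewrite (qvnorm_eq0 x0) mulmx0 -[0](scale0r 0) (qvnormZ 0) normr0 !mul0r
    mulr_ge0 ?qopnorm_ge0 ?qvnorm_ge0.
have x_gt0 : 0 < qvnorm x by rewrite lt_def x_neq0 qvnorm_ge0.
rewrite -ler_pdivrMr // mulrC -[X in X * _]gtr0_norm ?invr_gt0 //.
rewrite -qvnormZ -scalemx_realAr; apply: (ub_le_sup (qmulmx_bounded A)).
exists ((qvnorm x)^-1%:q *: x) => //=.
by rewrite qvnormZ gtr0_norm ?invr_gt0 // mulVf.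
Qed.

Lemma qopnorm_le (R : realType) (m n : nat) (A : 'M[quat R]_(m, n)) (c : R) :
  0 <= c -> (forall x, qvnorm (A *m x) <= c * qvnorm x) -> qopnorm A <= c.
Proof.
move=> c_ge0 Ac; rewrite /qopnorm; set S := (X in sup X).
have [->|/set0P S0] := eqVneq S set0; first by rewrite sup0.
by apply: ge_sup => // _ [x /= x1 <-]; rewrite (le_trans (Ac x)) // x1 mulr1.
Qed.

Lemma qopnormM_le (R : realType) (m n p : nat)
    (A : 'M[quat R]_(m, n)) (B : 'M[quat R]_(n, p)) :
  qopnorm (A *m B) <= qopnorm A * qopnorm B.
Proof.
apply: qopnorm_le => [|x]; first by rewrite mulr_ge0 ?qopnorm_ge0.
rewrite -mulmxA (le_trans (qvnorm_mulmx_le _ _)) // -mulrA.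
by rewrite ler_wpM2l ?qopnorm_ge0 // qvnorm_mulmx_le.
Qed.

Lemma qopnormX_le (R : realType) (n k : nat) (A : 'M[quat R]_n) :
  qopnorm (A ^+ k.+1) <= qopnorm A ^+ k.+1.
Proof.
elim: k => [|k IHk]; first by rewrite !expr1.
rewrite exprS [leRHS]exprS (le_trans (qopnormM_le _ _)) //.
by rewrite ler_wpM2l ?qopnorm_ge0.
Qed.

Lemma qopnormN (R : realType) (m n : nat) (A : 'M[quat R]_(m, n)) :
  qopnorm (- A) = qopnorm A.
Proof.
suff opN_le (B : 'M[quat R]_(m, n)) : qopnorm (- B) <= qopnorm B.
  apply: le_anti; apply/andP; split; first exact: opN_le.
  by have := opN_le (- A); rewrite opprK.
apply: qopnorm_le => [|x]; first exact: qopnorm_ge0.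
have -> : - B *m x = (- 1)%:q *: (B *m x).
  by rewrite mulNmx -scaleN1r (rmorphN1 (@qreal R)).
rewrite qvnormZ normrN1 mul1r; exact: qvnorm_mulmx_le.
Qed.

(** * The Moore-Penrose inverse *)

(** Both products are the orthogonal projection on the column space of [A]:
    each absorbs the other on its right, and taking adjoints exchanges the
    factors. So computations with [A *m mpinv A] may use the pseudoinverse
    read off a singular value decomposition. *)
Lemma is_mpinv_proj_unique (R : realType) (m n : nat) (A : 'M[quat R]_(m, n))
    (X Y : 'M[quat R]_(n, m)) :
  is_mpinv A X -> is_mpinv A Y -> A *m X = A *m Y.
Proof.
move=> [AXA _ AXh _] [AYA _ AYh _].
have AYAX : A *m Y *m (A *m X) = A *m X by rewrite mulmxA AYA.
by rewrite -AXh -AYAX qadjM AXh AYh mulmxA AXA.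
Qed.

(** Rectangular diagonal matrices, like [qsigma_mx], but with the diagonal
    given by a function, so that products and inverses of diagonals are taken
    pointwise. *)
Definition qdiag (R : comNzRingType) (m n : nat) (f : nat -> R) :
    'M[quat R]_(m, n) :=
  \matrix_(i < m, j < n) (if (i : nat) == j then (f i)%:q else 0).

Lemma eq_qdiag (R : comNzRingType) (m n : nat) (f g : nat -> R) :
  f =1 g -> qdiag m n f = qdiag m n g.
Proof. by move=> fg; apply/matrixP => i j; rewrite !mxE fg. Qed.

Lemma qadj_diag (R : comNzRingType) (m n : nat) (f : nat -> R) :
  qadj (qdiag m n f) = qdiag n m f.
Proof.
apply/matrixP => i j; rewrite !mxE eq_sym; case: eqP => [->|_].
  exact: qconj_real.
exact: (raddf0 (@qconj R)).
Qed.

(** The inner dimension [n] may be smaller than both outer ones; the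
    hypothesis says that nothing is lost when the diagonal is cut at [n]. *)
Lemma mul_qdiag (R : comNzRingType) (m n p : nat) (f g : nat -> R) :
    (forall k, (n <= k)%N -> f k * g k = 0) ->
  qdiag m n f *m qdiag n p g = qdiag m p (fun k => f k * g k).
Proof.
move=> fg0; apply/matrixP => i j; rewrite !mxE.
have [lt_in|le_ni] := ltnP i n.
  rewrite (bigD1 (Ordinal lt_in)) //= big1 => [|k].
    rewrite !mxE /= eqxx addr0; case: eqP => _; last by rewrite mulr0.
    by rewrite (rmorphM (@qreal R)).
  rewrite -val_eqE /= eq_sym => ne_ik.
  by rewrite !mxE (negbTE ne_ik) mul0r.
rewrite big1 => [|k _]; last first.
  by rewrite !mxE gtn_eqF ?mul0r // (leq_trans (ltn_ord k)).
by rewrite fg0 // (raddf0 (@qreal R)) if_same.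
Qed.

Lemma qdiag_comb (R : comNzRingType) (m n : nat) (a : R) (f g : nat -> R) :
  qdiag m n f - a%:q *: qdiag m n g = qdiag m n (fun k => f k - a * g k).
Proof.
apply/matrixP => i j; rewrite !mxE; case: eqP => _.
  by rewrite (rmorphB (@qreal R)) (rmorphM (@qreal R)).
by rewrite mulr0 subr0.
Qed.

Lemma svd_mulmx (R : comNzRingType) (k l m n q : nat)
    (U : 'M[quat R]_(m, k)) (D : 'M[quat R]_(k, n)) (V : 'M[quat R]_n)
    (E : 'M[quat R]_(n, l)) (W : 'M[quat R]_(q, l)) :
  qunitary V ->
  (U *m D *m qadj V) *m (V *m E *m qadj W) = U *m (D *m E) *m qadj W.
Proof. by case=> VV _; rewrite !mulmxA -(mulmxA (U *m D)) VV mulmx1. Qed.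

Lemma svd_qadj (R : comNzRingType) (m n : nat)
    (U : 'M[quat R]_m) (D : 'M[quat R]_(m, n)) (V : 'M[quat R]_n) :
  qadj (U *m D *m qadj V) = V *m qadj D *m qadj U.
Proof. by rewrite !qadjM qadjK mulmxA. Qed.

(** Since [0^-1 = 0] in the field of scalars, the pointwise inverse of the
    diagonal inverts the nonzero singular values and keeps the zero ones,
    which is what the pseudoinverse does. *)
Lemma svd_is_mpinv (R : realType) (m n : nat) (f : nat -> R)
    (U : 'M[quat R]_m) (V : 'M[quat R]_n) :
    (forall k, (minn m n <= k)%N -> f k = 0) -> qunitary U -> qunitary V ->
  is_mpinv (U *m qdiag m n f *m qadj V)
           (V *m qdiag n m (fun k => (f k)^-1) *m qadj U).
Proof.
move=> f0 Uu Vu.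
have fm k : (m <= k)%N -> f k = 0.
  by move=> le_mk; apply: f0; rewrite geq_min le_mk.
have fn k : (n <= k)%N -> f k = 0.
  by move=> le_nk; apply: f0; rewrite geq_min le_nk orbT.
have fVf k : f k * (f k)^-1 * f k = f k.
  by have [->|fk0] := eqVneq (f k) 0; rewrite ?mulr0 // divfK.
have VfV k : (f k)^-1 * f k * (f k)^-1 = (f k)^-1.
  by have [->|fk0] := eqVneq (f k) 0; rewrite ?invr0 ?mulr0 // mulVf ?mul1r.
have gn k : (n <= k)%N -> f k * (f k)^-1 = 0 by move=> /fn ->; rewrite mul0r.
have gm k : (m <= k)%N -> (f k)^-1 * f k = 0 by move=> /fm ->; rewrite mulr0.
have gfm k : (m <= k)%N -> f k * (f k)^-1 * f k = 0.
  by move=> /fm ->; rewrite mulr0.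
have gfn k : (n <= k)%N -> (f k)^-1 * f k * (f k)^-1 = 0.
  by move=> /fn ->; rewrite mulr0 mul0r.
split.
- rewrite (svd_mulmx _ _ _ _ Vu) (svd_mulmx _ _ _ _ Uu) (mul_qdiag _ _ gn).
  by rewrite (mul_qdiag _ _ gfm) (eq_qdiag _ _ fVf).
- rewrite (svd_mulmx _ _ _ _ Uu) (svd_mulmx _ _ _ _ Vu) (mul_qdiag _ _ gm).
  by rewrite (mul_qdiag _ _ gfn) (eq_qdiag _ _ VfV).
- by rewrite (svd_mulmx _ _ _ _ Vu) (mul_qdiag _ _ gn) svd_qadj qadj_diag.
- by rewrite (svd_mulmx _ _ _ _ Uu) (mul_qdiag _ _ gm) svd_qadj qadj_diag.
Qed.

(** The singular value decomposition gives a pseudoinverse, so the choice that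
    defines [mpinv] does not fall back on its default. *)
Lemma mpinvP (R : realType) (m n : nat) (A : 'M[quat R]_(m, n)) (s : seq R) :
  nonzero_singular_values A s -> is_mpinv A (mpinv A).
Proof.
case=> s_size _ _ [U [V [Uu Vu ->]]].
apply: (xgetPex 0 (P := is_mpinv _)).
exists (V *m qdiag n m (fun k => (s`_k)^-1) *m qadj U).
apply: (@svd_is_mpinv _ _ _ (nth 0 s)) => // k le_k.
by rewrite nth_default // (leq_trans s_size).
Qed.

(** * The initial residual *)

Lemma qvnorm_diag_le (R : realType) (n : nat) (c : R) (f : nat -> R)
    (x : 'cV[quat R]_n) :
  0 <= c -> (forall i : 'I_n, `|f i| <= c) ->
  qvnorm (qdiag n n f *m x) <= c * qvnorm x.
Proof.
move=> c_ge0 fc; rewrite -(ger0_norm c_ge0) -qvnormZ !qvnormE.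
rewrite ler_sqrt ?qvnormsq_ge0 //; apply: ler_sum => i _; rewrite !mxE.
rewrite (bigD1 i) //= big1 => [|k]; last first.
  by rewrite eq_sym -val_eqE /= => /negbTE ne_ik; rewrite !mxE ne_ik mul0r.
rewrite !mxE eqxx addr0 !qnormsqM !qnormsq_real ler_wpM2r ?qnormsq_ge0 //.
by rewrite -real_normK ?num_real // lerXn2r ?nnegrE.
Qed.

(** The matrix is unitarily similar to a diagonal one, whose entries are
    [1 - alpha * sigma ^+ 2] with [0 < sigma <= sigma1], or 0 beyond the rank.
    As [alpha * sigma1 ^+ 2 < 2], all of them have absolute value less than 1,
    and there are finitely many. *)
Lemma initial_residual_lt1 (R : realType) (m n : nat) (A : 'M[quat R]_(m, n))
    (sigma1 : R) (sigmas : seq R) (alpha : R) :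
    nonzero_singular_values A (sigma1 :: sigmas) ->
    0 < alpha < 2 / sigma1 ^+ 2 ->
  qopnorm (A *m mpinv A - alpha%:q *: (A *m qadj A)) < 1.
Proof.
move=> hA /andP[alpha_gt0 alpha_lt]; have Ainv := mpinvP hA.
case: hA Ainv; set s := _ :: _ => s_size s_sorted s_gt0 [U [V [Uu Vu ->]]] Ainv.
pose f := nth 0 s.
have f0 k : (minn m n <= k)%N -> f k = 0.
  by move=> le_k; rewrite /f nth_default // (leq_trans s_size).
have fn k : (n <= k)%N -> f k = 0.
  by move=> le_nk; apply: f0; rewrite geq_min le_nk orbT.
rewrite (is_mpinv_proj_unique Ainv (svd_is_mpinv f0 Uu Vu)).
have gn k : (n <= k)%N -> f k * (f k)^-1 = 0 by move=> /fn ->; rewrite mul0r.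
have hn k : (n <= k)%N -> f k * f k = 0 by move=> /fn ->; rewrite mul0r.
rewrite -/(qdiag m n f) svd_qadj !(svd_mulmx _ _ _ _ Vu) qadj_diag.
rewrite (mul_qdiag _ _ gn) (mul_qdiag _ _ hn).
rewrite scalemxAl -scalemx_realAr -mulmxBl -mulmxBr qdiag_comb.
set g := fun k : nat => _.
have g_lt1 (i : 'I_m) : `|g i| < 1.
  rewrite /g; have [lt_is|le_si] := ltnP i (size s); last first.
    by rewrite /f nth_default // !mul0r mulr0 subr0 normr0.
  have fs : f i \in s by exact: mem_nth.
  have f_gt0 : 0 < f i by exact: (allP s_gt0).
  have f_le : f i <= sigma1.
    move: fs; rewrite inE => /predU1P[->//|].
    have ge_trans : transitive (fun x y : R => y <= x).
      by move=> a b c ab bc; exact: le_trans bc ab.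
    exact: (allP (order_path_min ge_trans s_sorted)).
  rewrite divff ?gt_eqF //.
  have fsq_gt0 : 0 < f i * f i by rewrite mulr_gt0.
  have fsq_le : f i * f i <= sigma1 ^+ 2 by rewrite expr2 ler_pM // ltW.
  have : alpha * sigma1 ^+ 2 < 2.
    by rewrite -ltr_pdivlMr // (lt_le_trans fsq_gt0).
  have : alpha * (f i * f i) <= alpha * sigma1 ^+ 2 by rewrite ler_pM2l.
  have : 0 < alpha * (f i * f i) by rewrite mulr_gt0.
  by rewrite ltr_norml => *; apply/andP; split; lra.
(* The maximum starts from 0 and so covers an empty diagonal. *)
pose c := \big[Order.max/0]_(i < m) `|g i|.
have c_ge0 : 0 <= c by exact: bigmax_ge_id.
have c_lt1 : c < 1 by apply: bigmax_lt.
apply: le_lt_trans c_lt1; apply: qopnorm_le => // x.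
have [UU UU'] := Uu.
rewrite -!mulmxA qvnorm_unitary // (le_trans (qvnorm_diag_le _ c_ge0 _)) //.
  by move=> i; exact: le_bigmax.
by rewrite qvnorm_unitary // qadjK.
Qed.

(** * One step is a truncated Neumann series *)

(** The seven hypotheses say that the coefficients of t, ..., t^7 in the
    expanded left-hand side are 1. Here [d1 + d2] is the coefficient of t and
    of t^3 in [U], [u2] that of t^2; [v1] and [w1] are the coefficients of t in
    the two outer factors, and [w2] is that of t^2 in the second one. *)
Lemma factored_geometric (S : comNzRingType) (t d1 d2 d3 e1 e2 c1 c2 : S) :
  let v1 := d1 + d2 + d3 in let w1 := d1 + d2 + e1 in
  let u2 := 1 + 1 + d1 * d2 in let w2 := u2 + e2 in
  v1 + w1 + c1 = 1 ->
  u2 + w2 + v1 * w1 + c2 = 1 ->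
  (d1 + d2) + (d1 + d2) + (u2 * w1 + v1 * w2) = 1 ->
  1 + 1 + (d1 + d2) * (v1 + w1) + u2 * w2 = 1 ->
  v1 + w1 + (d1 + d2) * (u2 + w2) = 1 ->
  u2 + w2 + (d1 + d2) * (d1 + d2) = 1 ->
  (d1 + d2) + (d1 + d2) = 1 ->
  let U := (1 + d1 * t + t ^+ 2) * (1 + d2 * t + t ^+ 2) in
  (U + d3 * t) * (U + e1 * t + e2 * t ^+ 2) + c1 * t + c2 * t ^+ 2
    = \sum_(k < 9) t ^+ k.
Proof.
move=> v1 w1 u2 w2 t1 t2 t3 t4 t5 t6 t7 U.
transitivity (1 + (v1 + w1 + c1) * t
    + (u2 + w2 + v1 * w1 + c2) * t ^+ 2
    + ((d1 + d2) + (d1 + d2) + (u2 * w1 + v1 * w2)) * t ^+ 3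
    + (1 + 1 + (d1 + d2) * (v1 + w1) + u2 * w2) * t ^+ 4
    + (v1 + w1 + (d1 + d2) * (u2 + w2)) * t ^+ 5
    + (u2 + w2 + (d1 + d2) * (d1 + d2)) * t ^+ 6
    + ((d1 + d2) + (d1 + d2)) * t ^+ 7 + t ^+ 8).
  by rewrite /U /w2 /u2 /v1 /w1; ring.
rewrite t1 t2 t3 t4 t5 t6 t7 !big_ord_recr big_ord0 /=; ring.
Qed.

(** The radical in [coef_d1] and [coef_d2] only enters through their product,
    which is affine in [s = sqrt 93]; conjugate expressions in [s] then meet
    in each coefficient and leave only [s * s = 93]. With the variable [t] of
    the factored form equal to ['X^2], the factor ['X + 'X^2] interleaves the
    even powers into the full geometric sum. *)
Lemma qhpi19_poly (R : realType) :
  let c a : {poly R} := a%:P in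
  let U := (1 + c (coef_d1 R) * 'X^2 + 'X^4)
           * (1 + c (coef_d2 R) * 'X^2 + 'X^4) in
  let V := U + c (coef_d3 R) * 'X^2 in
  let W := U + c (coef_e1 R) * 'X^2 + c (coef_e2 R) * 'X^4 in
  let G := V * W + c (coef_c1 R) * 'X^2 + c (coef_c2 R) * 'X^4 in
  1 + ('X + 'X^2) * G = \sum_(k < 19) 'X^k.
Proof.
pose s : R := Num.sqrt 93.
have ss : s * s = 93 by rewrite -expr2 sqr_sqrtr ?ler0n.
pose q : R := Num.sqrt (27 - 2 * s).
have qq : q * q = 27 - 2 * s.
  by rewrite -expr2 sqr_sqrtr //; have := sqrtr_ge0 (93 : R); nra.
pose d1 := coef_d1 R; pose d2 := coef_d2 R.
pose v1 := d1 + d2 + coef_d3 R; pose w1 := d1 + d2 + coef_e1 R.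
pose u2 := 1 + 1 + d1 * d2; pose w2 := u2 + coef_e2 R.
have d12 : d1 + d2 = 1 / 2 by rewrite /d1 /d2 /coef_d1 /coef_d2; lra.
have u2E : u2 = (3 + s) / 8.
  rewrite /u2 /d1 /d2 /coef_d1 /coef_d2 -/s -/q.
  have -> : (1 + q) / 4 * ((1 - q) / 4) = (1 - q * q) / 16 by field.
  by rewrite qq; field.
have w2E : w2 = (3 - s) / 8 by rewrite /w2 u2E /coef_e2 -/s; field.
have v1E : v1 = (155 + 5 * s) / 496.
  by rewrite /v1 d12 /coef_d3 -/s; field.
have w1E : w1 = (155 - 5 * s) / 496.
  by rewrite /w1 d12 /coef_e1 -/s; field.
have t1 : v1 + w1 + coef_c1 R = 1 by rewrite v1E w1E /coef_c1; field.
have t2 : u2 + w2 + v1 * w1 + coef_c2 R = 1.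
  rewrite v1E w1E u2E w2E /coef_c2.
  have -> : (155 + 5 * s) / 496 * ((155 - 5 * s) / 496)
    = (155 ^+ 2 - 25 * (s * s)) / 496 ^+ 2 by field.
  by rewrite ss; field.
have t3 : (d1 + d2) + (d1 + d2) + (u2 * w1 + v1 * w2) = 1.
  rewrite d12 v1E w1E u2E w2E.
  have -> : (3 + s) / 8 * ((155 - 5 * s) / 496)
      + (155 + 5 * s) / 496 * ((3 - s) / 8)
    = (930 - 10 * (s * s)) / 3968 by field.
  by rewrite ss; field.
have t4 : 1 + 1 + (d1 + d2) * (v1 + w1) + u2 * w2 = 1.
  rewrite d12 v1E w1E u2E w2E.
  have -> : (3 + s) / 8 * ((3 - s) / 8) = (9 - s * s) / 64 by field.
  by rewrite ss; field.
have t5 : v1 + w1 + (d1 + d2) * (u2 + w2) = 1.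
  by rewrite d12 v1E w1E u2E w2E; field.
have t6 : u2 + w2 + (d1 + d2) * (d1 + d2) = 1.
  by rewrite d12 u2E w2E; field.
have t7 : (d1 + d2) + (d1 + d2) = 1 by rewrite d12; field.
move=> c U V W G.
rewrite /G /V /W /U.
have -> : 'X^4 = 'X^2 ^+ 2 :> {poly R} by rewrite -exprM.
rewrite factored_geometric; first 1 last.
- by rewrite -!(polyCD, polyCM) -/d1 -/d2 -/v1 -/w1 t1.
- by rewrite -!(polyCD, polyCM) -/d1 -/d2 -/v1 -/w1 -/u2 -/w2 t2.
- by rewrite -!(polyCD, polyCM) -/d1 -/d2 -/v1 -/w1 -/u2 -/w2 t3.
- by rewrite -!(polyCD, polyCM) -/d1 -/d2 -/v1 -/w1 -/u2 -/w2 t4.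
- by rewrite -!(polyCD, polyCM) -/d1 -/d2 -/v1 -/w1 -/u2 -/w2 t5.
- by rewrite -!(polyCD, polyCM) -/d1 -/d2 -/v1 -/w1 -/u2 -/w2 t6.
- by rewrite -!(polyCD, polyCM) -/d1 -/d2 t7.
rewrite !big_ord_recr !big_ord0 /=; ring.
Qed.

(** Reals act on quaternion matrices as a central subring. This morphism lets
    real polynomials be evaluated at a quaternion matrix, although quaternion
    matrices do not form an algebra over their own entries. *)
Definition qreal_mx (R : comNzRingType) (m : nat) (a : R) :
  'M[quat R]_m.+1 := (a%:q)%:M.

Lemma qreal_mx_is_additive (R : comNzRingType) (m : nat) :
  additive (@qreal_mx R m).
Proof. by move=> a b; rewrite /qreal_mx (rmorphB (@qreal R)) raddfB. Qed.

Lemma qreal_mx_is_monoid_morphism (R : comNzRingType) (m : nat) :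
  monoid_morphism (@qreal_mx R m).
Proof.
by split=> // a b; rewrite /qreal_mx (rmorphM (@qreal R)) /= scalar_mxM.
Qed.

HB.instance Definition _ (R : comNzRingType) (m : nat) :=
  GRing.isZmodMorphism.Build R 'M[quat R]_m.+1 (@qreal_mx R m)
    (@qreal_mx_is_additive R m).
HB.instance Definition _ (R : comNzRingType) (m : nat) :=
  GRing.isMonoidMorphism.Build R 'M[quat R]_m.+1 (@qreal_mx R m)
    (@qreal_mx_is_monoid_morphism R m).

Lemma qreal_mx_comm (R : comNzRingType) (m : nat) (r : 'M[quat R]_m.+1) :
  commr_rmorph (@qreal_mx R m) r.
Proof.
move=> a; change (r *m (a%:q)%:M = (a%:q)%:M *m r).
by rewrite mul_scalar_mx -[in LHS](scalemx1 m.+1) scalemx_realAr mulmx1.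
Qed.

Lemma qhpi19_stepE (R : realType) (m n : nat) (A : 'M[quat R]_(m, n))
    (X : 'M[quat R]_(n, m)) :
  qhpi19_step A X = X *m \sum_(k < 19) (1 - A *m X) ^+ k.
Proof.
(* Matrices of size 0 form the zero ring, where evaluation is not available. *)
case: m A X => [|m] A X; first by rewrite [LHS]thinmx0 [RHS]thinmx0.
rewrite /qhpi19_step; set r : 'M[quat R]_m.+1 := 1%:M - _.
pose ev := horner_morph (qreal_mx_comm r).
have evX k : ev 'X^k = r ^+ k by rewrite /ev rmorphXn /= horner_morphX.
have evC a p : ev (a%:P * p) = a%:q *: ev p.
  by rewrite /ev rmorphM /= horner_morphC -mul_scalar_mx.
have ev1 : ev 1 = 1 by exact: rmorph1.
have evD p q : ev (p + q) = ev p + ev q by exact: rmorphD.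
have evM p q : ev (p * q) = ev p * ev q by exact: rmorphM.
have evX1 : ev 'X = r by exact: horner_morphX.
have evS : ev (\sum_(k < 19) 'X^k) = \sum_(k < 19) r ^+ k.
  by rewrite /ev rmorph_sum; apply: eq_bigr => k _; exact: evX.
(* Forget the definition of the evaluation: only its morphism rules matter. *)
move: ev evX evC ev1 evD evM evX1 evS => ev evX evC ev1 evD evM evX1 evS.
congr (X *m _); rewrite -[RHS]evS -qhpi19_poly.
have evU a : ev (1 + a%:P * 'X^2 + 'X^4) = 1 + a%:q *: r ^+ 2 + r ^+ 4.
  by rewrite evD evD ev1 evC evX evX.
rewrite [RHS]evD ev1 evM [ev ('X + _)]evD evX1 evX.
do 2 rewrite evD evC evX.
rewrite evM [ev (_ + _ + _ * 'X^4)]evD [ev (_ + _ * 'X^2)]evD.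
rewrite [ev (_ + _ * 'X^2)]evD !evC !evX [ev (_ * _)]evM !evU.
by [].
Qed.

(** * The error formula and convergence *)

Lemma qhpi19_step_row (R : realType) (m n : nat) (A : 'M[quat R]_(m, n))
    (Y X : 'M[quat R]_(n, m)) :
  Y *m A *m X = X ->
  Y *m A *m qhpi19_step A X = qhpi19_step A X.
Proof. by move=> YAX; rewrite qhpi19_stepE mulmxA YAX. Qed.

(** Each term of the Neumann sum absorbs [A *m Y]: appending one more residual
    [1 - A *m X] keeps the last term and subtracts one that ends in [X]. *)
Lemma qhpi19_step_col (R : realType) (m n : nat) (A : 'M[quat R]_(m, n))
    (Y X : 'M[quat R]_(n, m)) :
  X *m A *m Y = X ->
  qhpi19_step A X *m A *m Y = qhpi19_step A X.
Proof.
move=> XAY; rewrite qhpi19_stepE mulmx_sumr !mulmx_suml; apply: eq_bigr => k _.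
elim: (k : nat) => [|i IHi]; first by rewrite expr0 mulmx1.
set r := 1 - A *m X in IHi *; rewrite exprSr -[r ^+ i * r]/(r ^+ i *m r).
rewrite {2}/r mulmxBr mulmx1 mulmxBr !mulmxBl IHi.
congr (_ - _); rewrite -!mulmxA; congr (X *m (_ *m (A *m _))).
by rewrite mulmxA XAY.
Qed.

(** The error is [Y *m r ^+ 19], since [A *m qhpi19_step A X] telescopes to
    [1 - r ^+ 19]. Behind [Y] each residual [r] acts as [F = A *m (Y - X)]:
    the two differ by [1 - A *m Y], which [Y] and [F] annihilate. *)
Lemma qhpi19_error (R : realType) (m n : nat) (A : 'M[quat R]_(m, n))
    (Y X : 'M[quat R]_(n, m)) :
  Y *m A *m X = X -> X *m A *m Y = X -> is_mpinv A Y ->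
  Y - qhpi19_step A X = Y *m (A *m (Y - X)) ^+ 19.
Proof.
move=> YAX XAY [_ YAY _ _]; pose r : 'M[quat R]_m := 1 - A *m X.
pose F : 'M[quat R]_m := A *m (Y - X).
have step : A *m qhpi19_step A X = 1 - r ^+ 19.
  rewrite qhpi19_stepE mulmxA -/r -[_ *m _]/(_ * _).
  by rewrite -[RHS]opprB subrX1 -mulNr opprB /r opprB addrCA subrr addr0.
have YrF : Y *m r = Y *m F.
  by rewrite /r /F mulmxBr mulmx1 !mulmxA mulmxBr YAY YAX.
have FrF : F *m r = F *m F.
  have FAY : F *m (A *m Y) = F.
    rewrite /F -!mulmxA; congr (A *m _).
    by rewrite mulmxA !mulmxBl YAY XAY.
  by rewrite /r mulmxBr mulmx1 -[X in X - _]FAY -(mulmxBr F) -(mulmxBr A).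
have Yrk k : Y *m r ^+ k.+1 = Y *m F ^+ k.+1.
  elim: k => [|k IHk]; first by rewrite !expr1.
  rewrite exprSr -[_ * _]/(_ *m _) mulmxA IHk -mulmxA; congr (Y *m _).
  rewrite exprSr -[_ * _]/(_ *m _) -mulmxA FrF mulmxA.
  by rewrite -[LHS]/(F ^+ k * F * F) -!exprSr.
rewrite -(qhpi19_step_row YAX) -mulmxA step mulmxBr mulmx1 opprB.
by rewrite addrCA subrr addr0.
Qed.

Lemma qadj_mpinv_row (R : realType) (m n : nat) (A : 'M[quat R]_(m, n))
    (Y : 'M[quat R]_(n, m)) :
  is_mpinv A Y -> Y *m A *m qadj A = qadj A.
Proof. by case=> AYA _ _ YAh; rewrite -YAh -qadjM mulmxA AYA. Qed.

Lemma qadj_mpinv_col (R : realType) (m n : nat) (A : 'M[quat R]_(m, n))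
    (Y : 'M[quat R]_(n, m)) :
  is_mpinv A Y -> qadj A *m A *m Y = qadj A.
Proof. by case=> AYA _ AYh _; rewrite -mulmxA -AYh -qadjM AYA. Qed.

Theorem theorem6 (R : realType) (m n : nat) (A : 'M[quat R]_(m, n))
    (sigma1 : R) (sigmas : seq R)
    (hA : nonzero_singular_values A (sigma1 :: sigmas))
    (alpha : R) (halpha : 0 < alpha < 2 / sigma1 ^+ 2)
    (X : nat -> 'M[quat R]_(n, m))
    (hX0 : X 0%N = alpha%:q *: qadj A)
    (hX : forall j : nat, X j.+1 = qhpi19_step A (X j)) :
  (fun j : nat => qopnorm (X j - mpinv A)) @ \oo --> (0 : R) /\
  (forall j : nat,
     qopnorm (X j.+1 - mpinv A) <=
       qopnorm (mpinv A) * qopnorm A ^+ 19 * qopnorm (X j - mpinv A) ^+ 19).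
Proof.
have Ainv := mpinvP hA; have F0_lt1 := initial_residual_lt1 hA halpha.
set Y := mpinv A in Ainv F0_lt1 *; have [AYA YAY _ _] := Ainv.
have YAX j : Y *m A *m X j = X j.
  elim: j => [|j IHj]; last by rewrite hX qhpi19_step_row.
  by rewrite hX0 scalemx_realAr qadj_mpinv_row.
have XAY j : X j *m A *m Y = X j.
  elim: j => [|j IHj]; last by rewrite hX qhpi19_step_col.
  by rewrite hX0 -!scalemxAl qadj_mpinv_col.
pose F j := A *m (Y - X j).
have err j : Y - X j.+1 = Y *m F j ^+ 19 by rewrite hX qhpi19_error.
have YF j : Y - X j = Y *m F j by rewrite /F mulmxA mulmxBr YAY YAX.
split=> [|j]; last first.
  rewrite -qopnormN opprB err (le_trans (qopnormM_le _ _)) // -mulrA.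
  rewrite ler_wpM2l ?qopnorm_ge0 // (le_trans (qopnormX_le _ _)) //.
  rewrite -exprMn lerXn2r ?nnegrE ?mulr_ge0 ?qopnorm_ge0 //.
  by rewrite -[X in _ * X]qopnormN opprB qopnormM_le.
have F_lt1 : qopnorm (F 0%N) < 1.
  by rewrite /F hX0 mulmxBr scalemx_realAr.
have [c F0c] : exists c, qopnorm (F 0%N) = c by exists (qopnorm (F 0%N)).
have c_ge0 : 0 <= c by rewrite -F0c qopnorm_ge0.
rewrite F0c in F_lt1.
(* The true decay is [c ^+ (19 ^ j)]; a geometric one is enough here. *)
have F_le j : qopnorm (F j) <= c ^+ j.+1.
  elim: j => [|j IHj]; first by rewrite F0c expr1.
  have -> : F j.+1 = F j ^+ 19.
    have AYF : A *m Y *m F j = F j by rewrite mulmxA AYA.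
    transitivity (A *m (Y *m F j ^+ 19)); first by rewrite -err.
    rewrite mulmxA exprS -[F j * F j ^+ 18]/(F j *m F j ^+ 18).
    by rewrite [LHS]mulmxA AYF.
  rewrite (le_trans (qopnormX_le _ _)) //.
  rewrite (le_trans (lerXn2r 19 _ _ IHj)) ?nnegrE ?exprn_ge0 ?qopnorm_ge0 //.
  rewrite -exprM; apply: ler_wiXn2l; [by [] | exact: ltW |].
  by rewrite ltn_Pmulr.
apply: (@squeeze_cvgr _ _ _ _ (fun=> 0) (fun j => qopnorm Y * c ^+ j)).
- apply: nearW => j; rewrite qopnorm_ge0 /= -qopnormN opprB YF.
  rewrite (le_trans (qopnormM_le _ _)) // ler_wpM2l ?qopnorm_ge0 //.
  apply: le_trans (F_le j) _; apply: ler_wiXn2l => //; exact: ltW.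
- exact: cvg_cst.
- rewrite -[X in _ --> X](mulr0 (qopnorm Y)); apply: cvgMr.
  by apply: cvg_expr; rewrite ger0_norm.
Qed.
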